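(* Let $c=10^{-3}$ and let $\varepsilon\le c/10$ be such that $1/\varepsilon^2$ and $1/(2\varepsilon^2)$ are integers. Consider the following distributional one-way communication problem. Alice has as input $n/2$ strings $s_1,\ldots,s_{n/2}\in\{0,1\}^{1/\varepsilon^2}$, each of Hamming weight $\frac{1}{2\varepsilon^2}$, and Bob has an index $i\in[n/2]$ together with one string $t\in\{0,1\}^{1/\varepsilon^2}$ of Hamming weight $\frac{1}{2\varepsilon^2}$, drawn as follows: $i$ is chosen uniformly at random; $s_i$ and $t$ are chosen uniformly at random (among strings of Hamming weight $\frac{1}{2\varepsilon^2}$) but conditioned on their Hamming distance $\Delta(s_i,t)$ being, with equal probability, either $\ge\frac{1}{2\varepsilon^2}+\frac{c}{\varepsilon}$ or $\le\frac{1}{2\varepsilon^2}-\frac{c}{\varepsilon}$; the remaining strings $s_{i'}$, $i'\ne i$, are chosen uniformly at random (among strings of Hamming weight $\frac{1}{2\varepsilon^2}$). Consider a (possibly randomized) one-way protocol in which Alice sends Bob an $m$-bit message and then Bob determines, with success probability at least $2/3$, whether $\Delta(s_i,t)$ is $\ge\frac{1}{2\varepsilon^2}+\frac{c}{\varepsilon}$ or $\le\frac{1}{2\varepsilon^2}-\frac{c}{\varepsilon}$. Then $m\ge\Omega(n/\varepsilon^2)$.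
   Context: $\Delta(\cdot,\cdot)$ denotes Hamming distance. The $\Omega(\cdot)$ hides an absolute constant independent of $n$ and $\varepsilon$. *)

(* Defs.v *)
From HB Require Import structures.
From mathcomp Require Import all_boot all_order all_algebra.
From mathcomp Require Import all_classical all_reals all_analysis.

Set Implicit Arguments.
Unset Strict Implicit.
Unset Printing Implicit Defensive.

Import Order.TTheory GRing.Theory Num.Theory.
Local Open Scope ring_scope.

Notation bits d := (d.-tuple bool).

Definition weight (d : nat) (u : bits d) : nat := #|[pred j | tnth u j]|.

Definition hamming (d : nat) (u v : bits d) : nat :=
  #|[pred j | tnth u j != tnth v j]|.

Definition gapc (R : realType) : R := 10 ^- 3.

Definition is_far (R : realType) (eps : R) (d : nat) (u v : bits d) : bool :=
  1 / (2 * eps ^+ 2) + gapc R / eps <= (hamming u v)%:R.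

Definition is_close (R : realType) (eps : R) (d : nat) (u v : bits d) : bool :=
  (hamming u v)%:R <= 1 / (2 * eps ^+ 2) - gapc R / eps.

Definition unif (R : realType) (T : finType) (A : pred T) (x : T) : R :=
  (A x)%:R / #|A|%:R.

(* k strings for Alice, then Bob's index and Bob's string. *)
Definition input (k d : nat) : finType :=
  ({ffun 'I_k -> bits d} * 'I_k * bits d)%type.

Definition far_pairs (R : realType) (eps : R) (d h : nat) :
    pred (bits d * bits d) :=
  fun p => [&& weight p.1 == h, weight p.2 == h & is_far eps p.1 p.2].

Definition close_pairs (R : realType) (eps : R) (d h : nat) :
    pred (bits d * bits d) :=
  fun p => [&& weight p.1 == h, weight p.2 == h & is_close eps p.1 p.2].

(* Probability mass function: the index is uniform; given the index i, a fair
   coin decides whether (s i, t) is uniform over the far or over the close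
   pairs, and the s j with j != i are independent and uniform. *)
Definition mass (R : realType) (eps : R) (k d h : nat) (x : input k d) : R :=
  let: (s, i, t) := x in
  unif R predT i
  * (1 / 2 * unif R (far_pairs eps h) (s i, t)
     + 1 / 2 * unif R (close_pairs eps h) (s i, t))
  * \prod_(j | j != i) unif R (fun u : bits d => weight u == h) (s j).

(* Om is the space of random coins.  Both players may read them, so private
   coins are the special case of a product space of which each player reads
   one factor. *)
Record protocol (disp : measure_display) (Om : measurableType disp)
    (k d m : nat) := Protocol {
  alice : Om -> {ffun 'I_k -> bits d} -> bits m;
  bob : Om -> bits m -> 'I_k -> bits d -> bool;
  measurable_alice : forall s M,
    measurable [set w | alice w s = M]%classic;
  measurable_bob : forall M i t,
    measurable [set w | bob w M i t]%classic }.

(* Bob's answer true claims that the pair is far, false that it is close. *)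
Definition correct (R : realType) (eps : R) (d : nat) (b : bool)
    (u v : bits d) : bool :=
  if b then is_far eps u v else is_close eps u v.

Definition success (R : realType) (eps : R) (k d h m : nat)
    (disp : measure_display) (Om : measurableType disp)
    (P : probability Om R) (prot : protocol Om k d m) : \bar R :=
  (\sum_(x : input k d)
     (mass eps h x)%:E *
     P [set w | correct eps (bob prot w (alice prot w x.1.1) x.1.2 x.2)
                  (x.1.1 x.1.2) x.2]%classic)%E.

(* Main.v *)
Require Import Defs.
From HB Require Import structures.
From mathcomp Require Import all_boot all_order all_algebra all_fingroup.
From mathcomp Require Import all_classical all_reals all_analysis.
From mathcomp Require Import measurable_realfun.
From mathcomp Require Import ring lra zify.

Set Implicit Arguments.
Unset Strict Implicit.
Unset Printing Implicit Defensive.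

Import Order.TTheory GRing.Theory Num.Theory.
Local Open Scope ring_scope.

(* Let W be the set of strings of weight h, N = #|W|, let g(s, t) be 1, -1 or 0
   according to whether (s, t) is far, close or neither, and let K(s, s') be
   the average over t in W of g(s, t) g(s', t).

   The complement exchanges far and close pairs, so a protocol of success
   probability p has 2p - 1 proportional to the average of (+-1) g(s_i, t), the
   sign being Bob's answer.  By Cauchy-Schwarz the square of this average is at
   most the average, over two tuples s, s' compatible with the same message, of
   the mean over i of K(s_i, s'_i).  If the average of exp(lam K(s, s')) over s
   in W is at most exp(phi) for every s' in W, exponential moments in the
   product space bound this by (m ln 2 / k + phi) / lam.

   It remains to have phi <= lam / 200 with lam of order d = 2h.  Since K has
   mean zero this is a second-order expansion for bounded d.  For large d,
   K(s, s') is small unless the distance of s and s' deviates from h by a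
   constant fraction of d, which is exponentially rare.  To see that K is small,
   permute coordinates fixing s so that s' becomes almost its own complement;
   this changes the sign of K up to the probability that the distance of s' and
   t crosses a threshold, controlled by a second moment and the bound
   3 N / sqrt d on the number of t in W at a given distance. *)

(** * From the advantage of a protocol to the length of its message *)

Definition corr (R : realType) (T : finType) (W : pred T) (g : T -> T -> R)
    (s s' : T) : R :=
  #|W|%:R^-1 * \sum_(t | W t) g s t * g s' t.

(** Convexity of the exponential, with the tangent taken at [ln r]; leaving [r] free lets the caller
    balance the two terms. *)
Lemma ln_tangent (R : realType) (r x : R) : 0 < r ->
  x <= ln r - 1 + expR x / r.
Proof.
move=> r0; have := expR_ge1Dx (x - ln r).
rewrite expRD expRN lnK ?posrE //; lra.
Qed.

(** The exponential of a sum over coordinates is a product, so the sum over tuples factors into one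
    sum per coordinate. *)
Lemma sum_expR_ffun (R : realType) (T : finType) (W : pred T) (k : nat)
    (F : T -> T -> R) (phi : R) :
  (forall s', W s' -> \sum_(s | W s) expR (F s s') <= #|W|%:R * expR phi) ->
  forall s' : {ffun 'I_k -> T}, s' \in ffun_on W ->
  \sum_(s : {ffun 'I_k -> T} | s \in ffun_on W)
      expR (\sum_i F (s i) (s' i)) <= #|W|%:R ^+ k * expR (k%:R * phi).
Proof.
move=> H s' /ffun_onP s'W.
under eq_bigr do rewrite expR_sum.
rewrite -(bigA_distr_big _ (fun i s => expR (F s (s' i)))) expRM_natl -exprMn.
rewrite -[X in _ ^+ X]card_ord -prodr_const.
by apply: ler_prod => i _; rewrite sumr_ge0 ?H //; exact: s'W.
Qed.

(** Completing the square: this is Cauchy-Schwarz in a form linear in [b * G], ready to be summed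
    over messages. The weight [a] will count the tuples sent to one message, possibly none, hence
    the case [a = 0]. *)
Lemma weighted_AMGM (R : realFieldType) (theta b G a : R) :
  0 <= a -> (a = 0 -> G = 0) -> b ^+ 2 <= 1 ->
  2 * theta * (b * G) <= theta ^+ 2 * a + a^-1 * G ^+ 2.
Proof.
rewrite le_eqVlt => /predU1P[<- /(_ erefl)-> _|a0 _ b1].
  by rewrite expr0n !mulr0 addr0.
have E : a^-1 * G ^+ 2 - 2 * theta * (b * G) + theta ^+ 2 * b ^+ 2 * a
         = a^-1 * (G - theta * b * a) ^+ 2.
  field; exact: lt0r_neq0.
have H1 : 0 <= a^-1 * (G - theta * b * a) ^+ 2.
  by rewrite mulr_ge0 ?sqr_ge0 // invr_ge0 ltW.
have H2 : theta ^+ 2 * b ^+ 2 * a <= theta ^+ 2 * a.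
  by rewrite -mulrA ler_wpM2l ?sqr_ge0 // ler_piMl // ltW.
lra.
Qed.

(* The counting form of the chain rule for mutual information: the tangent
   line to the logarithm at the constant #|Msg| * expR (k * phi) replaces the
   entropy of the message. *)
Lemma advantage_le_message_size (R : realType) (T Msg : finType) (W : pred T)
    (g : T -> T -> R) (k : nat) (lam phi theta : R)
    (A : {ffun 'I_k -> T} -> Msg) (b : Msg -> 'I_k -> T -> R) :
  (0 < #|W|)%N -> 0 <= lam -> 0 <= theta ->
  (forall M i t, b M i t ^+ 2 <= 1) ->
  (forall s', W s' ->
     \sum_(s | W s) expR (lam * corr W g s s') <= #|W|%:R * expR phi) ->
  theta * (#|W|%:R ^+ k.+1 * k%:R) <=
    \sum_(s : {ffun 'I_k -> T} | s \in ffun_on W)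
       \sum_i \sum_(t | W t) b (A s) i t * g (s i) t ->
  lam * k%:R * theta ^+ 2 <= ln #|Msg|%:R + k%:R * phi.
Proof.
move=> W0 lam0 theta0 b1 Hexp Hadv.
set N : R := #|W|%:R in Hexp Hadv *.
have N0 : 0 < N by rewrite ltr0n.
(* [a M] is the size of the class of tuples sent to [M], [G M i t] the sum of [g] over it, and [Z]
   is k times the mean correlation of two tuples. *)
pose a M : R := \sum_(s | (s \in ffun_on W) && (A s == M)) 1.
pose G M i t : R := \sum_(s | (s \in ffun_on W) && (A s == M)) g (s i) t.
pose Z (s s' : {ffun 'I_k -> T}) := \sum_i corr W g (s i) (s' i).
have a_ge0 M : 0 <= a M by exact: sumr_ge0.
have suma : \sum_M a M = N ^+ k.
  rewrite /a -(partition_big A xpredT) // sumr_const card_ffun_on card_ord.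
  by rewrite natrX.
have aG M i t : a M = 0 -> G M i t = 0.
  move=> aM0; have /psumr_eq0P H := aM0.
  apply: big1 => s Hs.
  by have /eqP := H (fun _ _ => ler01) s Hs; rewrite oner_eq0.
have Msg0 : (0 < #|Msg|)%N.
  have [w _] : exists w, w \in W by apply/card_gt0P.
  by apply/card_gt0P; exists (A [ffun => w]).
have adv : \sum_(s : {ffun 'I_k -> T} | s \in ffun_on W)
       \sum_i \sum_(t | W t) b (A s) i t * g (s i) t =
       \sum_M \sum_i \sum_(t | W t) b M i t * G M i t.
  rewrite (partition_big A xpredT) //=; apply: eq_bigr => M _.
  under eq_bigr => s /andP[_ /eqP ->] do [].
  rewrite exchange_big /=; apply: eq_bigr => i _.
  rewrite exchange_big /=; apply: eq_bigr => t _.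
  by rewrite mulr_sumr.
have quad M : \sum_i \sum_(t | W t) G M i t ^+ 2 =
    N * \sum_(s' | (s' \in ffun_on W) && (A s' == M))
          \sum_(s | (s \in ffun_on W) && (A s == M)) Z s s'.
  under [in RHS]eq_bigr do rewrite exchange_big /=.
  rewrite [in RHS]exchange_big /= mulr_sumr; apply: eq_bigr => i _.
  under [in RHS]eq_bigr do rewrite -mulr_sumr exchange_big /=.
  rewrite -mulr_sumr mulVKf ?gt_eqF // [in RHS]exchange_big /=.
  apply: eq_bigr => t _; rewrite expr2 /G mulr_sumr; apply: eq_bigr => s _.
  by rewrite mulr_suml.
(* AM-GM is used with its parameter equal to the advantage [theta]: the assumed lower bound counts
   twice and the term with [a M] takes one copy back. *)
have step1 : theta ^+ 2 * (N ^+ k.+1 * k%:R) <=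
    \sum_M (a M)^-1 * \sum_i \sum_(t | W t) G M i t ^+ 2.
  have : 2 * theta * (\sum_M \sum_i \sum_(t | W t) b M i t * G M i t) <=
      \sum_M (theta ^+ 2 * a M * (k%:R * N)
              + (a M)^-1 * \sum_i \sum_(t | W t) G M i t ^+ 2).
    rewrite mulr_sumr; apply: ler_sum => M _.
    have -> : theta ^+ 2 * a M * (k%:R * N) =
       \sum_(i < k) \sum_(t | W t) theta ^+ 2 * a M.
      under eq_bigr do rewrite sumr_const.
      rewrite sumr_const card_ord -[RHS]mulr_natr -[X in _ = X * _]mulr_natr.
      by rewrite -[RHS]mulrA [_ * k%:R]mulrC.
    rewrite [2 * _ * _]mulr_sumr [_^-1 * _]mulr_sumr -big_split /=; apply: ler_sum => i _.
    rewrite [2 * _ * _]mulr_sumr [_^-1 * _]mulr_sumr -big_split /=; apply: ler_sum => t _.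
    by apply: weighted_AMGM => // /aG.
  rewrite big_split /= -mulr_suml -mulr_sumr suma -adv => H.
  have := ler_wpM2l theta0 Hadv; rewrite (exprS N k); lra.
have step2 : theta ^+ 2 * (N ^+ k * k%:R) <=
    \sum_M (a M)^-1 * \sum_(s' | (s' \in ffun_on W) && (A s' == M))
          \sum_(s | (s \in ffun_on W) && (A s == M)) Z s s'.
  rewrite -(ler_pM2l N0) mulr_sumr.
  under eq_bigr do rewrite mulrCA -quad.
  apply: le_trans step1; rewrite (exprS N k) le_eqVlt.
  by apply/orP; left; apply/eqP; ring.
(* With this [r], the exponential terms for a fixed s' sum over all tuples s to at most
   [N ^+ k / #|Msg|]; over all messages this cancels the -1 of the tangent line. *)
pose r : R := #|Msg|%:R * expR (k%:R * phi).
have r0 : 0 < r by rewrite mulr_gt0 ?expR_gt0 ?ltr0n.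
have lnr : ln r = ln #|Msg|%:R + k%:R * phi.
  by rewrite lnM ?posrE ?expR_gt0 ?ltr0n // expRK.
have step3 M : (a M)^-1 * \sum_(s' | (s' \in ffun_on W) && (A s' == M))
      \sum_(s | (s \in ffun_on W) && (A s == M)) lam * Z s s' <=
    a M * (ln r - 1) + N ^+ k / #|Msg|%:R.
  have C0 : 0 <= N ^+ k / #|Msg|%:R by rewrite divr_ge0 ?exprn_ge0 ?ler0n // ltW.
  have [aM0|aMn0] := eqVneq (a M) 0; first by rewrite aM0 invr0 !mul0r add0r.
  rewrite ler_pdivrMl ?lt_neqAle 1?eq_sym ?aMn0 ?a_ge0 //.
  rewrite [X in _ <= X * _]/a mulr_suml; apply: ler_sum => s' /andP[s'W _]; rewrite mul1r.
  apply: (@le_trans _ _ (\sum_(s | (s \in ffun_on W) && (A s == M))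
     (1 * (ln r - 1) + r^-1 * expR (lam * Z s s')))).
    by apply: ler_sum => s _; rewrite mul1r [r^-1 * _]mulrC ln_tangent.
  rewrite big_split /= -mulr_suml lerD2l -mulr_sumr.
  apply: (@le_trans _ _ (r^-1 * \sum_(s : {ffun 'I_k -> T} | s \in ffun_on W)
      expR (\sum_i lam * corr W g (s i) (s' i)))).
    (* Every [expR] is nonnegative, so s may range over all tuples and not only over the class of
       [M]. *)
    rewrite ler_pM2l ?invr_gt0 // big_mkcondr /=; apply: ler_sum => s _.
    by rewrite /Z mulr_sumr; case: ifP => // _; exact: expR_ge0.
  have /(_ _ s'W) H := @sum_expR_ffun R T W k (fun s s' => lam * corr W g s s') phi Hexp.
  apply: (le_trans (ler_wpM2l _ H)); first by rewrite invr_ge0 ltW.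
  rewrite /r le_eqVlt; apply/orP; left; apply/eqP; field.
  by rewrite !gt_eqF ?expR_gt0 ?ltr0n.
have := ler_wpM2l lam0 step2; rewrite mulr_sumr => H.
rewrite -lnr -(ler_pM2l (exprn_gt0 k N0)).
apply: (@le_trans _ _ (lam * (theta ^+ 2 * (N ^+ k * k%:R)))).
  by rewrite le_eqVlt; apply/orP; left; apply/eqP; ring.
apply: (le_trans H).
apply: (@le_trans _ _ (\sum_M (a M * (ln r - 1) + N ^+ k / #|Msg|%:R))).
  apply: ler_sum => M _; apply: le_trans (step3 M); rewrite mulrCA.
  by rewrite mulr_sumr; under eq_bigr do rewrite mulr_sumr.
rewrite big_split /= -mulr_suml suma sumr_const.
rewrite -[X in _ + X <= _]mulr_natr divfK ?pnatr_eq0 -?lt0n //.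
by rewrite le_eqVlt; apply/orP; left; apply/eqP; ring.
Qed.

(** * Bounds on binomial coefficients *)

Lemma central_binS (n : nat) :
  (n.+1 * 'C(n.+1.*2, n.+1) = 2 * (n.*2.+1 * 'C(n.*2, n)))%N.
Proof.
have H1 := mul_bin_diag n.+1.*2 n.
have H2 := mul_bin_down n.*2.+1 n.
have E : (n.*2.+1 - n = n.+1)%N by lia.
rewrite doubleS /= E in H1 H2 *; nia.
Qed.

(** The central coefficient is at least 4^n / (2 sqrt n). By the recurrence, the induction step
    reduces to 4n(n+1) <= (2n+1)^2. *)
Lemma central_bin_lower (n : nat) :
  (0 < n)%N -> (16 ^ n <= 4 * (n * 'C(n.*2, n) ^ 2))%N.
Proof.
elim: n => // -[_ _|n IH _]; first by [].
have := IH isT; have := central_binS n.+1; rewrite (expnS _ n.+1).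
move: {IH}n.+1 (ltn0Sn n) => p p0.
move: 'C(p.*2, p) 'C(_, _) (16 ^ p)%N => c c' q E H.
rewrite -(@leq_pmul2l p.+1) //.
have -> : (p.+1 * (4 * (p.+1 * c' ^ 2)) = 4 * (p.+1 * c') ^ 2)%N by lia.
rewrite {}E; apply: (@leq_trans (p.+1 * (16 * (4 * (p * c ^ 2))))).
  by rewrite !leq_mul2l H !orbT.
lia.
Qed.

(** Here the induction step reduces to (2n+1)(2n+3) <= 4(n+1)^2. *)
Lemma central_bin_upper (n : nat) :
  (n.*2.+1 * 'C(n.*2, n) ^ 2 <= 16 ^ n)%N.
Proof.
elim: n => // n; have := central_binS n; rewrite (expnS 16).
move: 'C(_, n) 'C(_, _) (16 ^ n)%N => c c' q E H.
rewrite -(@leq_pmul2l (n.+1 * n.+1)) //.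
have -> : (n.+1 * n.+1 * (n.+1.*2.+1 * c' ^ 2) = n.+1.*2.+1 * (n.+1 * c') ^ 2)%N
  by lia.
rewrite {}E; apply: (@leq_trans (n.+1 * n.+1 * (16 * (n.*2.+1 * c ^ 2)))); first lia.
by rewrite !leq_mul2l H !orbT.
Qed.

Lemma leq_bin_half (n j : nat) : ('C(n, j) <= 'C(n, n./2))%N.
Proof.
have up i : (i.*2 < n)%N -> ('C(n, i) <= 'C(n, i.+1))%N.
  move=> ilt; rewrite -(@leq_pmul2l i.+1) // mul_bin_left leq_mul2r.
  by apply/orP; right; lia.
have low i : (i <= n./2)%N -> ('C(n, i) <= 'C(n, n./2))%N.
  move=> ile; rewrite -(subKn ile); elim: (_ - i)%N (leq_subr i n./2) => [|k IH] kle.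
    by rewrite subn0.
  apply: leq_trans (IH (ltnW kle)).
  have -> : (n./2 - k = (n./2 - k.+1).+1)%N by lia.
  by apply: up; lia.
have [/low//|jgt] := leqP j n./2.
have [jle|jgtn] := leqP j n; last by rewrite bin_small.
by rewrite -bin_sub //; apply: low; lia.
Qed.

Lemma bin_sqr_upper (n j : nat) : (n.+1 * 'C(n, j) ^ 2 <= 4 ^ n)%N.
Proof.
apply: (@leq_trans (n.+1 * 'C(n, n./2) ^ 2)).
  by rewrite leq_mul2l leq_sqr leq_bin_half orbT.
rewrite -{1 2 4}(odd_double_half n).
case: (odd n); rewrite ?add0n ?add1n; last first.
  by have := central_bin_upper n./2; rewrite -mul2n (expnM 4 2).
(* For odd n the middle coefficient is half of the next central one. *)
set m := n./2; have := central_bin_upper m.+1.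
have -> : ('C(m.+1.*2, m.+1) = 2 * 'C(m.*2.+1, m))%N.
  rewrite doubleS binS -[in X in (X + _)%N]bin_sub; last by lia.
  have -> : (m.*2.+1 - m.+1 = m)%N by lia.
  lia.
have -> : (16 ^ m.+1 = 4 * 4 ^ m.*2.+1)%N.
  by rewrite -expnS -doubleS -mul2n (expnM 4 2).
move: (4 ^ _)%N ('C(_, _)) => a b; nia.
Qed.

(** * Weight slices of the cube, overlaps and complements *)

Definition slice (d h : nat) : pred (bits d) := fun u => weight u == h.

Definition overlap (d : nat) (u v : bits d) : nat :=
  \sum_(j < d) (tnth u j && tnth v j).

Definition compl (d : nat) (u : bits d) : bits d := [tuple ~~ tnth u j | j < d].

Lemma weightE (d : nat) (u : bits d) : weight u = (\sum_(j < d) tnth u j)%N.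
Proof.
rewrite /weight -sum1_card big_mkcond; apply: eq_bigr => j _.
by rewrite inE; case: (tnth u j).
Qed.

Lemma hammingE (d : nat) (u v : bits d) :
  hamming u v = (\sum_(j < d) (tnth u j != tnth v j))%N.
Proof.
rewrite /hamming -sum1_card big_mkcond; apply: eq_bigr => j _.
by rewrite inE; case: (_ != _).
Qed.

Lemma hammingC (d : nat) (u v : bits d) : hamming u v = hamming v u.
Proof. by rewrite !hammingE; apply: eq_bigr => j _; rewrite eq_sym. Qed.

Lemma hamming_overlap (d : nat) (u v : bits d) :
  (hamming u v + 2 * overlap u v = weight u + weight v)%N.
Proof.
rewrite hammingE /overlap !weightE big_distrr -!big_split /=.
by apply: eq_bigr => j _; case: (tnth u j); case: (tnth v j).
Qed.

Lemma complK (d : nat) : involutive (@compl d).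
Proof. by move=> u; apply: eq_from_tnth => j; rewrite !tnth_mktuple negbK. Qed.

Lemma weight_compl (d : nat) (u : bits d) : (weight u + weight (compl u) = d)%N.
Proof.
rewrite !weightE -big_split /=; under eq_bigr do rewrite tnth_mktuple.
rewrite -[RHS]card_ord -sum1_card; apply: eq_bigr => j _; by case: (tnth u j).
Qed.

Lemma hamming_compl (d : nat) (u v : bits d) :
  (hamming u v + hamming (compl u) v = d)%N.
Proof.
rewrite !hammingE -big_split /=; under eq_bigr do rewrite tnth_mktuple.
rewrite -[RHS]card_ord -sum1_card; apply: eq_bigr => j _.
by case: (tnth u j); case: (tnth v j).
Qed.

Definition supp (d : nat) (u : bits d) : {set 'I_d} := [set j | tnth u j].

Lemma supp_inj (d : nat) : injective (@supp d).
Proof. by move=> u v /setP E; apply: eq_from_tnth => j; have := E j; rewrite !inE. Qed.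

Lemma card_supp (d : nat) (u : bits d) : #|supp u| = weight u.
Proof. by rewrite cardsE. Qed.

Lemma card_suppI (d : nat) (u v : bits d) : #|supp u :&: supp v| = overlap u v.
Proof.
rewrite -sum1_card big_mkcond; apply: eq_bigr => j _; rewrite !inE.
by case: (_ && _).
Qed.

Lemma card_slice (d h : nat) : #|slice (d:=d) h| = 'C(d, h).
Proof.
rewrite -[in RHS](card_ord d) -card_draws -(card_imset _ (@supp_inj d)).
apply: eq_card => A; rewrite inE; apply/imsetP/idP => [[u uh ->]|Ah].
  by rewrite card_supp.
have E : supp [tuple j \in A | j < d] = A.
  by apply/setP => j; rewrite inE tnth_mktuple.
by exists [tuple j \in A | j < d] => //; rewrite unfold_in /slice -card_supp E.
Qed.

(** The distance e fixes the overlap j of t with u, and t is determined by its j ones inside the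
    support of u and its h - j ones outside. For odd e there is no such t, so rounding in the half
    is harmless. *)
Lemma card_slice_hamming (h e : nat) (u : bits h.*2) : weight u = h ->
  (#|[pred t | slice h t & hamming u t == e]| <= 'C(h, (h.*2 - e)./2) ^ 2)%N.
Proof.
move=> uh; set j := (_ - e)./2.
have Ej t : slice h t -> hamming u t == e -> overlap u t = j /\ (j <= h)%N.
  move=> /eqP th /eqP te; have := hamming_overlap u t; rewrite uh th te /j; lia.
pose f (t : bits h.*2) := (supp t :&: supp u, supp t :\: supp u).
have f_inj : injective f.
  move=> t t' [E1 E2]; apply: supp_inj.
  by rewrite -(finset.setID (supp t) (supp u)) E1 E2 finset.setID.
have [t0 /andP[t0h t0e]|no] := pickP [pred t | slice h t & hamming u t == e]; last first.
  by rewrite eq_card0 // => t; exact: no.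
have [_ jh] := Ej _ t0h t0e.
pose D1 := [set A : {set 'I_h.*2} | A \subset supp u & #|A| == j].
pose D2 := [set A : {set 'I_h.*2} | A \subset ~: supp u & #|A| == (h - j)%N].
rewrite -(card_imset _ f_inj); apply: (@leq_trans #|finset.setX D1 D2|).
  apply: subset_leq_card; apply/fintype.subsetP => _ /imsetP[t /andP[th te] ->].
  have [tj _] := Ej _ th te; move: (th) => /eqP th'.
  rewrite !inE /= finset.subsetIr finset.setIC card_suppI tj eqxx /=.
  rewrite finset.subDset finset.setUCr finset.subsetT /=.
  by rewrite cardsD card_supp finset.setIC card_suppI tj th'.
have cC : #|~: supp u| = h.
  by rewrite cardsCs finset.setCK card_supp uh card_ord -addnn addnK.
by rewrite cardsX !cards_draws cC card_supp uh bin_sub // -mulnn.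
Qed.

(** * Size of the middle slice and anticoncentration of the distance *)

Lemma card_slice_gt0 (h : nat) : (0 < #|slice (d:=h.*2) h|)%N.
Proof. by rewrite card_slice bin_gt0 -addnn leq_addr. Qed.

(** The polynomial loss is affordable: the bound is only set against an exponentially small tail. *)
Lemma card_slice_lower (h : nat) : (0 < h)%N ->
  (4 ^ h <= h.*2 * #|slice (d:=h.*2) h|)%N.
Proof.
move=> h0; rewrite card_slice -leq_sqr -expnM mulnC (expnM 4 2).
apply: (leq_trans (central_bin_lower h0)); nia.
Qed.

(** The count is at most 4^h / (h+1) and the slice has at least 4^h / (2 sqrt h) elements. With r =
    sqrt (2h) this gives the factor 2 sqrt 2, rounded up to 3. *)
Lemma slice_point_upper (R : realType) (h e : nat) (r : R) (u : bits h.*2) :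
  (0 < h)%N -> 0 <= r -> r ^+ 2 = h.*2%:R -> weight u = h ->
  #|[pred t | slice h t & hamming u t == e]|%:R * r
    <= 3 * #|slice (d:=h.*2) h|%:R.
Proof.
move=> h0 r0 r2 uh.
have H1 := card_slice_hamming e uh; have H2 := bin_sqr_upper h (h.*2 - e)./2.
have := central_bin_lower h0; rewrite -card_slice.
move: #|[pred t | _]| #|slice _| H1 H2 => c N; move: 'C(_, _) => b H1 H2 H3.
have H4 : (h * c ^ 2 <= 4 * N ^ 2)%N.
  rewrite -(@leq_pmul2l h) //.
  have : ((h.+1 * c) ^ 2 <= (4 ^ h) ^ 2)%N.
    by rewrite leq_sqr; apply: leq_trans H2; rewrite leq_mul2l H1 orbT.
  rewrite -expnM (mulnC h 2) (expnM 4 2) mulnCA => H5.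
  apply: leq_trans (leq_trans H5 H3).
  by rewrite mulnA mulnn -expnMn leq_sqr leq_mul2r leqnSn orbT.
rewrite -ler_sqr ?nnegrE ?mulr_ge0 ?ler0n // !exprMn r2 -!natrX -!natrM ler_nat.
by rewrite -mul2n; nia.
Qed.

(** An interval of length l contains at most l + 1 integers, and each is charged by
    [slice_point_upper]. *)
Lemma slice_slab_upper (R : realType) (h : nat) (r x l : R) (u : bits h.*2) :
  (0 < h)%N -> 0 <= r -> r ^+ 2 = h.*2%:R -> 0 <= l -> weight u = h ->
  #|[pred t | slice h t & x <= (hamming u t)%:R <= x + l]|%:R * r
    <= 3 * (l + 1) * #|slice (d:=h.*2) h|%:R.
Proof.
move=> h0 r0 r2 l0 uh; set P := [pred t | _ & _]; set N := #|slice _|.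
have [t0 Pt0|no] := pickP P; last first.
  by rewrite eq_card0 // mul0r !mulr_ge0 ?addr_ge0 ?ler0n.
(* Distances are indexed from the smallest one attained in the slab, which avoids rounding the real
   number x. *)
have [t1 /andP[_ /andP[t1x _]] t1min] : exists2 t1, P t1 &
    forall t, P t -> (hamming u t1 <= hamming u t)%N.
  by case: (arg_minnP (hamming u) Pt0) => t1 Pt1 H; exists t1.
set e := hamming u t1 in t1x t1min; set L := Num.trunc l.
have bound t : P t -> (hamming u t - e < L.+1)%N.
  move=> Pt; have := t1min _ Pt; have /andP[_ /andP[_ tl]] := Pt => et.
  by rewrite ltnS truncn_ge_nat // natrB //; lra.
rewrite -sum1_card natr_sum.
rewrite (partition_big (fun t => inord (hamming u t - e) : 'I_L.+1) xpredT) //=.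
apply: (@le_trans _ _ (\sum_(i < L.+1) 3 * N%:R)).
  rewrite mulr_suml; apply: ler_sum => i _.
  apply: le_trans (slice_point_upper (e + i) h0 r0 r2 uh).
  rewrite ler_wpM2r // -natr_sum sum1_card ler_nat.
  apply: subset_leq_card; apply/fintype.subsetP => t; rewrite !inE => /andP[Pt /eqP <-].
  rewrite inordK ?bound // subnKC ?t1min // eqxx andbT.
  by case/andP: Pt.
rewrite sumr_const card_ord -[_ *+ L.+1]mulr_natr mulrAC ler_wpM2r // ler_wpM2l //.
by rewrite -natr1 lerD2r truncn_le.
Qed.

(** * The gap kernel g and its sensitivity to the distance *)

Definition gapf (R : realType) (h : nat) (Gam x : R) : R :=
  (h%:R + Gam <= x)%R%:R - (x <= h%:R - Gam)%R%:R.

Definition gapk (R : realType) (h d : nat) (Gam : R) (u v : bits d) : R :=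
  gapf h Gam (hamming u v)%:R.

(** If x and y are at least T apart, the quadratic term pays for the maximal change 2. Otherwise
    [gapf] can change only if x is within T of a threshold; these windows are written by lower end
    and length to fit [slice_slab_upper]. *)
Lemma gapfB_upper (R : realType) (h : nat) (Gam T x y : R) : 0 < T ->
  `|gapf h Gam x - gapf h Gam y| <=
    2 * ((x - y) ^+ 2 / T ^+ 2
         + (h%:R + Gam - T <= x <= h%:R + Gam - T + 2 * T)%R%:R
         + (h%:R - Gam - T <= x <= h%:R - Gam - T + 2 * T)%R%:R).
Proof.
move=> T0; have T2 : 0 < T ^+ 2 by rewrite exprn_gt0.
have q0 : 0 <= (x - y) ^+ 2 / T ^+ 2 by rewrite divr_ge0 ?sqr_ge0 // ltW.
have b01 (b : bool) : 0 <= (b%:R : R) <= 1 by rewrite ler0n lern1 leq_b1.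
have [far|near] := leP (T ^+ 2) ((x - y) ^+ 2).
  have q1 : 1 <= (x - y) ^+ 2 / T ^+ 2 by rewrite ler_pdivlMr // mul1r.
  rewrite /gapf ler_norml; move: q1.
  move: (b01 (h%:R + Gam <= x)) (b01 (h%:R + Gam <= y)) (b01 (x <= h%:R - Gam))
    (b01 (y <= h%:R - Gam)) (b01 (h%:R + Gam - T <= x <= h%:R + Gam - T + 2 * T))
    (b01 (h%:R - Gam - T <= x <= h%:R - Gam - T + 2 * T)); lra.
have xyT : `|x - y| < T by rewrite -ltr_sqr ?nnegrE ?(ltW T0) // real_normK ?num_real.
rewrite ltr_norml in xyT.
have [_|out1] := boolP (h%:R + Gam - T <= x <= _).
  rewrite /gapf ler_norml /=; move: q0.
  move: (b01 (h%:R + Gam <= x)) (b01 (h%:R + Gam <= y)) (b01 (x <= h%:R - Gam))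
    (b01 (y <= h%:R - Gam)) (b01 (h%:R - Gam - T <= x <= h%:R - Gam - T + 2 * T)); lra.
have [_|out2] := boolP (h%:R - Gam - T <= x <= _).
  rewrite /gapf ler_norml /=; move: q0.
  move: (b01 (h%:R + Gam <= x)) (b01 (h%:R + Gam <= y)) (b01 (x <= h%:R - Gam))
    (b01 (y <= h%:R - Gam)); lra.
suff -> : gapf h Gam x = gapf h Gam y by rewrite subrr normr0 mulr_ge0 // !addr0.
rewrite /gapf; congr (_%:R - _%:R); congr nat_of_bool.
  by apply/idP/idP => H; move: out1; rewrite negb_and -!ltNge => /orP[]; lra.
by apply/idP/idP => H; move: out2; rewrite negb_and -!ltNge => /orP[]; lra.
Qed.

(** * Symmetries of the slice and the second moment of a difference of distances *)

Definition permute (d : nat) (p : {perm 'I_d}) (u : bits d) : bits d :=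
  [tuple tnth u (p j) | j < d].

Lemma permute_inj (d : nat) (p : {perm 'I_d}) : injective (permute p).
Proof.
move=> u v E; apply: eq_from_tnth => j.
by have := congr1 (fun w => tnth w (p^-1 j)%g) E; rewrite !tnth_mktuple permKV.
Qed.

Lemma weight_permute (d : nat) (p : {perm 'I_d}) (u : bits d) :
  weight (permute p u) = weight u.
Proof.
rewrite !weightE [RHS](reindex_inj (@perm_inj _ p)).
by apply: eq_bigr => j _; rewrite tnth_mktuple.
Qed.

Lemma hamming_permute (d : nat) (p : {perm 'I_d}) (u v : bits d) :
  hamming (permute p u) (permute p v) = hamming u v.
Proof.
rewrite !hammingE [RHS](reindex_inj (@perm_inj _ p)).
by apply: eq_bigr => j _; rewrite !tnth_mktuple.
Qed.

Lemma sum_slice_permute (R : realType) (d h : nat) (p : {perm 'I_d})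
    (F : bits d -> R) :
  \sum_(t | slice h t) F t = \sum_(t | slice h t) F (permute p t).
Proof.
rewrite (reindex_inj (@permute_inj d p)).
by apply: eq_bigl => t; rewrite /slice weight_permute.
Qed.

Lemma sum_slice_compl (R : realType) (h : nat) (F : bits h.*2 -> R) :
  \sum_(t | slice h t) F t = \sum_(t | slice h t) F (compl t).
Proof.
rewrite (reindex_inj (inv_inj (@complK _))).
apply: eq_bigl => t; rewrite /slice; have := weight_compl t; lia.
Qed.

(* For a balanced vector c the equality of the mixed second moments makes the
   off-diagonal part of the quadratic form nonpositive. *)
Lemma slice_second_moment (R : realType) (d h : nat) (c : 'I_d -> R) :
  \sum_j c j = 0 ->
  \sum_(t : bits d | slice h t) (\sum_j c j * (tnth t j)%:R) ^+ 2
    <= #|slice (d:=d) h|%:R * \sum_j c j ^+ 2.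
Proof.
move=> c0; pose B i j : R := \sum_(t : bits d | slice h t) (tnth t i)%:R * (tnth t j)%:R.
have Bge0 i j : 0 <= B i j by apply: sumr_ge0 => t _; rewrite mulr_ge0.
have Ble i j : B i j <= #|slice (d:=d) h|%:R.
  rewrite -sum1_card natr_sum; apply: ler_sum => t _; rewrite -natrM ler_nat.
  by case: (tnth t i); case: (tnth t j).
(* The transposition of j and j' preserves the slice and fixes i. *)
have Bperm i j j' : j != i -> j' != i -> B i j = B i j'.
  move=> ji j'i; rewrite /B (sum_slice_permute _ (tperm j j')).
  by apply: eq_bigr => t _; rewrite !tnth_mktuple tpermL tpermD.
have -> : \sum_(t : bits d | slice h t) (\sum_j c j * (tnth t j)%:R) ^+ 2
    = \sum_i c i * \sum_j c j * B i j.
  under eq_bigr => t _.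
    rewrite expr2 mulr_suml; under eq_bigr do rewrite mulr_sumr.
    over.
  rewrite exchange_big /=; apply: eq_bigr => i _.
  rewrite exchange_big /= mulr_sumr; apply: eq_bigr => j _.
  by rewrite /B !mulr_sumr; apply: eq_bigr => t _; ring.
rewrite mulr_sumr; apply: ler_sum => i _.
have [j0 j0i|no] := pickP (fun j => j != i); last first.
  rewrite (bigD1 i) //= big_pred0 // addr0 mulrA -expr2 mulrC.
  by rewrite ler_wpM2r ?sqr_ge0.
(* All off-diagonal entries of a row are equal, and their coefficients sum to - c i. *)
have -> : \sum_j c j * B i j = c i * (B i i - B i j0).
  rewrite (bigD1 i) //=.
  under eq_bigr => j ji do rewrite (Bperm i j j0 ji j0i).
  rewrite -mulr_suml; have := c0; rewrite (bigD1 i) //= => /eqP.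
  by rewrite addrC addr_eq0 => /eqP ->; ring.
rewrite mulrA -expr2 mulrC ler_wpM2r ?sqr_ge0 //.
by have := Bge0 i j0; have := Ble i i; lra.
Qed.

(** The difference of the distances is affine in t with slope -2(u - v), and its constant term
    vanishes by equality of the weights. The squared norm of u - v is the distance of u and v. *)
Lemma sum_hammingB_sqr (R : realType) (d h : nat) (u v : bits d) :
  weight u = weight v ->
  \sum_(t : bits d | slice h t) ((hamming u t)%:R - (hamming v t)%:R : R) ^+ 2
    <= 4 * (hamming u v)%:R * #|slice (d:=d) h|%:R.
Proof.
move=> uv; pose c j : R := (tnth u j)%:R - (tnth v j)%:R.
have c0 : \sum_j c j = 0.
  by rewrite sumrB -!natr_sum -!weightE uv subrr.
have -> : (hamming u v)%:R = \sum_j c j ^+ 2.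
  rewrite hammingE natr_sum; apply: eq_bigr => j _; rewrite /c.
  by case: (tnth u j); case: (tnth v j) => /=; ring.
have E t : ((hamming u t)%:R - (hamming v t)%:R : R) ^+ 2 =
    4 * (\sum_j c j * (tnth t j)%:R) ^+ 2.
  have -> : (hamming u t)%:R - (hamming v t)%:R
      = \sum_j c j - 2 * \sum_j c j * (tnth t j)%:R :> R.
    rewrite !hammingE !natr_sum mulr_sumr -!sumrB; apply: eq_bigr => j _; rewrite /c.
    by case: (tnth u j); case: (tnth v j); case: (tnth t j) => /=; ring.
  by rewrite c0; ring.
under eq_bigr do rewrite E.
rewrite -mulr_sumr -[4 * _ * _]mulrA ler_wpM2l // mulrC.
exact: slice_second_moment.
Qed.

(** Sum of [gapfB_upper] over the slice: the second moment controls the quadratic term, and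
    anticoncentration the two windows of length 2T. *)
Lemma sum_gapkB_upper (R : realType) (h : nat) (Gam r T : R) (u v : bits h.*2) :
  (0 < h)%N -> 0 < r -> r ^+ 2 = h.*2%:R -> 0 < T ->
  weight u = h -> weight v = h ->
  \sum_(t | slice h t) `|gapk h Gam u t - gapk h Gam v t|
    <= #|slice (d:=h.*2) h|%:R *
       (8 * (hamming u v)%:R / T ^+ 2 + 12 * (2 * T + 1) / r).
Proof.
move=> h0 r0 r2 T0 uh vh; set N : R := #|slice _|%:R.
have slab x : \sum_(t | slice h t) (x <= (hamming u t)%:R <= x + 2 * T)%R%:R
    <= 3 * (2 * T + 1) * N / r.
  rewrite ler_pdivlMr //.
  have T20 : 0 <= 2 * T by rewrite mulr_ge0 // ltW.
  apply: le_trans (slice_slab_upper x h0 (ltW r0) r2 T20 uh).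
  by rewrite ler_pM2r // -natr_sum -sum1_card big_mkcondr.
have S1 := slab (h%:R + Gam - T); have S2 := slab (h%:R - Gam - T).
have S0 := @sum_hammingB_sqr R _ h u v (etrans uh (esym vh)).
apply: (@le_trans _ _ (\sum_(t | slice h t) 2 *
  (((hamming u t)%:R - (hamming v t)%:R) ^+ 2 / T ^+ 2
    + (h%:R + Gam - T <= (hamming u t)%:R <= h%:R + Gam - T + 2 * T)%R%:R
    + (h%:R - Gam - T <= (hamming u t)%:R <= h%:R - Gam - T + 2 * T)%R%:R))).
  by apply: ler_sum => t _; exact: gapfB_upper.
rewrite -mulr_sumr !big_split /= -mulr_suml.
have T2 : 0 < T ^+ 2 by rewrite exprn_gt0.
have /ler_wpM2r/(_ _ _ S0) : 0 <= (T ^+ 2)^-1 by rewrite invr_ge0 ltW.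
rewrite -/N; lra.
Qed.

(** * Correlations are small unless the distance is atypical *)

Lemma exists_subset_card (T : finType) (A : {set T}) (k : nat) :
  (k <= #|A|)%N -> exists2 B : {set T}, B \subset A & #|B| = k.
Proof.
rewrite -bin_gt0 -cards_draws => /card_gt0P[B].
by rewrite inE => /andP[BA /eqP Bk]; exists B.
Qed.

(** The weights and the overlap determine how often each of the four pairs of bits occurs, so the
    two lists of pairs are permutations of one another. *)
Lemma exists_permute (d : nat) (s u v : bits d) :
  weight u = weight v -> overlap s u = overlap s v ->
  exists p, permute p s = s /\ permute p u = v.
Proof.
move=> uv suv.
pose X (w : bits d) : d.-tuple (bool * bool) := [tuple (tnth s j, tnth w j) | j < d].
pose n (w : bits d) (x : bool * bool) := (\sum_(j < d) ((tnth s j, tnth w j) == x))%N.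
have cnt w x : count_mem x (X w) = n w x.
  rewrite -sum1_count big_mkcond /= big_map big_enum /=.
  by apply: eq_bigr => j _; case: (_ == _).
have n11 w : n w (true, true) = overlap s w.
  by apply: eq_bigr => j _; case: (tnth s j); case: (tnth w j).
have n1 w : (n w (true, true) + n w (true, false) = weight s)%N.
  rewrite weightE -big_split; apply: eq_bigr => j _ /=.
  by case: (tnth s j); case: (tnth w j).
have n2 w : (n w (true, true) + n w (false, true) = weight w)%N.
  rewrite weightE -big_split; apply: eq_bigr => j _ /=.
  by case: (tnth s j); case: (tnth w j).
have n3 w : (weight s + n w (false, true) + n w (false, false) = d)%N.
  rewrite weightE -!big_split /= -[RHS]card_ord -sum1_card; apply: eq_bigr => j _ /=.
  by case: (tnth s j); case: (tnth w j).
have /tuple_permP[p E] : perm_eq (X v) (X u).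
  apply/allP => x _ /=; rewrite !cnt; apply/eqP.
  move: (n11 u) (n11 v) (n1 u) (n1 v) (n2 u) (n2 v) (n3 u) (n3 v).
  rewrite uv suv; case: x => [[] []];
  move: (n u (true, true)) (n u (true, false)) (n u (false, true)) (n u (false, false));
  move: (n v (true, true)) (n v (true, false)) (n v (false, true)) (n v (false, false));
  move: (weight s) (weight v) (overlap s v) => ? ? ? x1 x2 x3 x4 y1 y2 y3 y4; lia.
have Ej j : (tnth s j, tnth v j) = (tnth s (p j), tnth u (p j)).
  by have := congr1 (fun w => tnth w j) (val_inj E : X v = _); rewrite !tnth_mktuple.
by exists p; split; apply: eq_from_tnth => j; rewrite tnth_mktuple; have [] := Ej j.
Qed.

Lemma gapk_compl (R : realType) (h : nat) (Gam : R) (u t : bits h.*2) :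
  gapk h Gam (compl u) t = - gapk h Gam u t.
Proof.
have E : (hamming u t)%:R + (hamming (compl u) t)%:R = h%:R + h%:R :> R.
  by rewrite -!natrD hamming_compl addnn.
rewrite /gapk /gapf opprB.
congr (_%:R - _%:R); congr nat_of_bool; apply/idP/idP; lra.
Qed.

Lemma gapk_permute (R : realType) (d h : nat) (Gam : R) (p : {perm 'I_d})
    (u t : bits d) :
  gapk h Gam (permute p u) (permute p t) = gapk h Gam u t.
Proof. by rewrite /gapk hamming_permute. Qed.

Lemma gapk_norm_le1 (R : realType) (d h : nat) (Gam : R) (u t : bits d) :
  `|gapk h Gam u t| <= 1.
Proof.
rewrite /gapk /gapf; case: (h%:R + _ <= _)%R; case: (_ <= h%:R - _)%R => /=;
  by rewrite ?subrr ?subr0 ?sub0r ?normrN ?normr0 ?normr1.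
Qed.

(* A copy [v] of [s'] relative to [s] that nearly equals [compl s']: as
   [gapk] is odd under [compl], the correlation of [s] and [s'] nearly
   cancels itself. *)
Lemma exists_near_compl (h : nat) (s s' : bits h.*2) :
  weight s = h -> weight s' = h -> (h <= hamming s s')%N ->
  exists2 v, weight v = h & [/\ overlap s s' = overlap s v &
    (hamming v (compl s') = 2 * (hamming s s' - h))%N].
Proof.
move=> sh s'h hle; have ov := hamming_overlap s s'.
set x := (hamming s s' - h)%N.
(* The string v is the complement of s' flipped on [L1] and [L2]: flipping [L1] lowers the overlap
   with s to that of s', and [L2] restores the weight. *)
have [L1 /fintype.subsetP L1s L1x] :
    exists2 L : {set 'I_h.*2}, L \subset supp s :\: supp s' & #|L| = x.
  apply: exists_subset_card; rewrite cardsD card_suppI card_supp sh; lia.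
have [L2 /fintype.subsetP L2s L2x] :
    exists2 L : {set 'I_h.*2}, L \subset supp s' :\: supp s & #|L| = x.
  apply: exists_subset_card; rewrite cardsD finset.setIC card_suppI card_supp s'h; lia.
have {}L1s j : (j \in L1) ==> (tnth s j && ~~ tnth s' j).
  by apply/implyP => /L1s; rewrite !inE andbC.
have {}L2s j : (j \in L2) ==> (~~ tnth s j && tnth s' j).
  by apply/implyP => /L2s; rewrite !inE.
have cardE (L : {set 'I_h.*2}) : #|L| = (\sum_j (j \in L))%N.
  by rewrite -sum1_card big_mkcond; apply: eq_bigr => j _; case: (_ \in _).
pose v : bits h.*2 := [tuple (~~ tnth s' j) (+) ((j \in L1) || (j \in L2)) | j < h.*2].
have wv : (weight v + weight s' + #|L1| = h.*2 + #|L2|)%N.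
  rewrite !weightE !cardE -[X in (X + _)%N = _]big_split /= -big_split /=.
  rewrite -[X in (X + _)%N]card_ord -sum1_card -big_split; apply: eq_bigr => j _ /=.
  rewrite tnth_mktuple; move: (L1s j) (L2s j).
  by case: (j \in L1); case: (j \in L2); case: (tnth s j); case: (tnth s' j).
have ovv : (overlap s v + #|L1| + overlap s s' = weight s)%N.
  rewrite !weightE !cardE /overlap -!big_split; apply: eq_bigr => j _ /=.
  rewrite tnth_mktuple; move: (L1s j) (L2s j).
  by case: (j \in L1); case: (j \in L2); case: (tnth s j); case: (tnth s' j).
have hv : (hamming v (compl s') = #|L1| + #|L2|)%N.
  rewrite hammingE !cardE -big_split; apply: eq_bigr => j _ /=.
  rewrite !tnth_mktuple; move: (L1s j) (L2s j).
  by case: (j \in L1); case: (j \in L2); case: (tnth s j); case: (tnth s' j).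
by exists v; [lia | split; lia].
Qed.

(** A permutation fixing s replaces s' by v in the correlation. Adding the two expressions leaves
    twice the sum equal to a sum over g(v, t) - g([compl s'], t), to which [sum_gapkB_upper] applies
    at distance 2([hamming s s'] - h). *)
Lemma corr_gapk_far (R : realType) (h : nat) (Gam r T : R) (s s' : bits h.*2) :
  (0 < h)%N -> 0 < r -> r ^+ 2 = h.*2%:R -> 0 < T ->
  weight s = h -> weight s' = h -> (h <= hamming s s')%N ->
  `|corr (slice h) (gapk h Gam) s s'| <=
    8 * (hamming s s' - h)%N%:R / T ^+ 2 + 6 * (2 * T + 1) / r.
Proof.
move=> h0 r0 r2 T0 sh s'h hle; set N : R := #|slice (d:=h.*2) h|%:R.
have N0 : 0 < N by rewrite ltr0n card_slice_gt0.
have [v vh [ov hv]] := exists_near_compl sh s'h hle.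
have [p [ps ps']] := exists_permute (etrans s'h (esym vh)) ov.
set g := gapk h Gam.
have c'h : weight (compl s') = h by have := weight_compl s'; lia.
have E1 : \sum_(t | slice h t) g s t * g s' t = \sum_(t | slice h t) g s t * g v t.
  rewrite [RHS](sum_slice_permute _ p); apply: eq_bigr => t _.
  by rewrite -{2}ps -ps' /g !gapk_permute.
have E2 : 2 * (\sum_(t | slice h t) g s t * g s' t) =
    \sum_(t | slice h t) g s t * (g v t - g (compl s') t).
  rewrite mulr_natl mulr2n {2}E1 -big_split /=; apply: eq_bigr => t _.
  by rewrite /g gapk_compl; ring.
have H := sum_gapkB_upper Gam h0 r0 r2 T0 vh c'h; rewrite hv -/N -/g in H.
have H2 : 2 * `|\sum_(t | slice h t) g s t * g s' t| <=
    \sum_(t | slice h t) `|g v t - g (compl s') t|.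
  rewrite -{1}[2]ger0_norm // -normrM E2; apply: (le_trans (ler_norm_sum _ _ _)).
  apply: ler_sum => t _; rewrite normrM ler_piMl ?normr_ge0 //.
  exact: gapk_norm_le1.
have T2 : T != 0 by rewrite gt_eqF.
rewrite /corr normrM normfV (ger0_norm (ler0n _ _)) -/N ler_pdivrMl //.
rewrite natrM in H.
set q := (hamming s s' - h)%N%:R in H *; set S := \sum_(t | _) _ in H2.
have E3 : N * (8 * q / T ^+ 2 + 6 * (2 * T + 1) / r) =
   2^-1 * (N * (8 * (2 * q) / T ^+ 2 + 12 * (2 * T + 1) / r)).
  by field; rewrite (gt_eqF r0).
by rewrite E3; lra.
Qed.

Lemma corr_compl (R : realType) (h : nat) (Gam : R) (s s' : bits h.*2) :
  corr (slice h) (gapk h Gam) (compl s) s' = - corr (slice h) (gapk h Gam) s s'.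
Proof.
rewrite /corr -mulrN -sumrN; congr (_ * _); apply: eq_bigr => t _.
by rewrite gapk_compl mulNr.
Qed.

(** Taking T = gam r balances the two error terms: they are at most 1/10^4 and 18/10^4, together
    below 1/500. Distances below h are reduced to those above by complementing s, which only changes
    the sign. *)
Lemma corr_gapk_upper (R : realType) (h : nat) (Gam r gam eta : R)
    (s s' : bits h.*2) :
  10 ^+ 4 <= r -> r ^+ 2 = h.*2%:R -> weight s = h -> weight s' = h ->
  0 < gam -> 10 ^+ 5 * gam <= 1 -> 10 ^+ 5 * eta <= gam ^+ 2 ->
  `|(hamming s s')%:R - h%:R : R| <= eta * h.*2%:R ->
  `|corr (slice h) (gapk h Gam) s s'| <= 500^-1.
Proof.
move=> r4 r2 sh s'h gam0 gam1 eta1; have r0 : 0 < r by apply: lt_le_trans r4.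
have h0 : (0 < h)%N.
  by case: (h) r2 => // /eqP; rewrite expf_eq0 /= gt_eqF.
have T0 : 0 < gam * r by rewrite mulr_gt0.
have main (u : bits h.*2) : weight u = h -> (h <= hamming u s')%N ->
    (hamming u s' - h)%N%:R <= eta * h.*2%:R ->
    `|corr (slice h) (gapk h Gam) u s'| <= 500^-1.
  move=> uh hle H; apply: (le_trans (corr_gapk_far Gam h0 r0 r2 T0 uh s'h hle)).
  have H1 : 8 * (hamming u s' - h)%N%:R / (gam * r) ^+ 2 <= 10 ^- 4.
    rewrite ler_pdivrMr ?exprn_gt0 // exprMn r2.
    have := ler_wpM2r (ler0n R h.*2) eta1; nra.
  have H2 : 6 * (2 * (gam * r) + 1) / r <= 18 / 10 ^+ 4.
    rewrite ler_pdivrMr //; have := ler_wpM2r (ltW r0) gam1; lra.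
  lra.
rewrite ler_norml => /andP[H1 H2].
have [hle|hlt] := leqP h (hamming s s').
  by apply: main => //; rewrite natrB.
have hc := hamming_compl s s'.
rewrite -normrN -corr_compl; apply: main; [|lia|].
  by have := weight_compl s; lia.
have -> : (hamming (compl s) s' - h = h - hamming s s')%N by lia.
rewrite natrB ?(ltnW hlt) //; lra.
Qed.

(** * Exponential moments of the correlation *)

Lemma expR_le_quadratic (R : realType) (x : R) : `|x| <= 3^-1 ->
  expR x <= 1 + x + x ^+ 2.
Proof.
rewrite ler_norml => /andP[xl xu].
have sq : 0 <= x ^+ 2 by rewrite sqr_ge0.
have inv (y : R) : y < 1 -> expR y <= (1 - y)^-1.
  move=> y1; rewrite -[expR y]invrK -expRN lef_pV2 ?posrE ?expR_gt0 ?subr_gt0 //.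
  exact: expR_ge1Dx.
have [x0|x0] := leP x 0.
  apply: (le_trans (inv x _)); first by lra.
  rewrite -[leLHS]mul1r ler_pdivrMr; nra.
(* For positive x the bound 1 / (1 - x) is too large; its version at x / 2, squared, is small enough
   up to 1/3. *)
have -> : x = x / 2 + x / 2 by lra.
have /inv H : x / 2 < 1 by lra.
rewrite expRD; apply: (le_trans (ler_pM (expR_ge0 _) (expR_ge0 _) H H)).
rewrite -invfM -[leLHS]mul1r ler_pdivrMr; nra.
Qed.

Lemma sum_bits_prod (R : realType) (d : nat) (F : 'I_d -> bool -> R) :
  \sum_(s : bits d) \prod_j F j (tnth s j) = \prod_j (F j true + F j false).
Proof.
under [RHS]eq_bigr => j _.
  have -> : F j true + F j false = \sum_b F j b by rewrite big_bool.
  over.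
rewrite bigA_distr_bigA /=.
pose f (s : {ffun 'I_d -> bool}) : bits d := [tuple s j | j < d].
have bf : bijective f.
  exists (fun s : bits d => [ffun j => tnth s j]) => s.
    by apply/ffunP => j; rewrite ffunE tnth_mktuple.
  by apply: eq_from_tnth => j; rewrite tnth_mktuple ffunE.
rewrite (reindex f) /=; last exact: onW_bij.
by apply: eq_bigr => s _; apply: eq_bigr => j _; rewrite tnth_mktuple.
Qed.

(** Chernoff bound on the whole cube, where the bits are independent: at parameter 2 eta each
    coordinate contributes exp eta + exp (- eta), at most 2 exp (eta^2). *)
Lemma hamming_tail (R : realType) (h : nat) (eta : R) (s' : bits h.*2) :
  0 <= eta -> eta <= 3^-1 ->
  #|[pred s : bits h.*2 | eta * h.*2%:R < (hamming s s')%:R - h%:R]|%:R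
    <= 4 ^+ h * expR (- (eta ^+ 2 * h.*2%:R)).
Proof.
move=> e0 e1; set d := h.*2.
pose F (j : 'I_d) (b : bool) : R := expR (eta * (if b != tnth s' j then 1 else -1)).
have E (s : bits d) : \prod_j F j (tnth s j) =
    expR (2 * eta * ((hamming s s')%:R - h%:R)).
  rewrite -expR_sum; congr expR; rewrite -mulr_sumr.
  have -> : h%:R = 2^-1 * \sum_(j < d) (1 : R).
    by rewrite sumr_const card_ord /d -muln2 -mulr_natr natrM; field.
  rewrite hammingE natr_sum -[2 * eta]mulrC -mulrA; congr (_ * _).
  rewrite mulrBr mulVKf // mulr_sumr -sumrB; apply: eq_bigr => j _.
  by case: (_ != _) => /=; ring.
have mgf : \sum_(s : bits d) expR (2 * eta * ((hamming s s')%:R - h%:R)) <=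
    4 ^+ h * expR (eta ^+ 2 * d%:R).
  under eq_bigr do rewrite -E.
  rewrite sum_bits_prod.
  have -> : 4 ^+ h * expR (eta ^+ 2 * d%:R) = \prod_(j < d) (2 * expR (eta ^+ 2)).
    rewrite prodr_const card_ord exprMn -expRM_natr /d -mul2n exprM.
    by congr (_ ^+ _ * _); ring.
  apply: ler_prod => j _; rewrite addr_ge0 ?expR_ge0 //=.
  have e3 : `|eta| <= 3^-1 by rewrite ger0_norm.
  have Hp := expR_le_quadratic e3; rewrite -normrN in e3.
  have Hm := expR_le_quadratic e3.
  have Hq := expR_ge1Dx (eta ^+ 2).
  rewrite sqrrN in Hm.
  by rewrite /F; case: (tnth s' j) => /=; rewrite !mulr1 !mulrN1; lra.
have : expR (2 * eta ^+ 2 * d%:R) *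
   #|[pred s : bits d | eta * d%:R < (hamming s s')%:R - h%:R]|%:R <=
    4 ^+ h * expR (eta ^+ 2 * d%:R).
  apply: le_trans mgf; rewrite -sum1_card natr_sum mulr_sumr.
  rewrite big_mkcond; apply: ler_sum => s _; rewrite inE.
  case: ifP => [H|_]; last exact: expR_ge0.
  rewrite mulr1 ler_expR expr2 mulrA -mulrA ler_wpM2l ?mulr_ge0 //.
  exact: ltW.
rewrite -ler_pdivlMl ?expR_gt0 // -expRN mulrCA -expRD => H.
by apply: (le_trans H); rewrite ler_wpM2l ?exprn_ge0 // ler_expR; lra.
Qed.

(** The lower tail for s' is the upper tail for its complement, and passing from the cube to the
    slice costs the factor 2h of [card_slice_lower]. *)
Lemma slice_hamming_tail (R : realType) (h : nat) (eta : R) (s' : bits h.*2) :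
  (0 < h)%N -> 0 <= eta -> eta <= 3^-1 ->
  #|[pred s | slice h s & eta * h.*2%:R < `|(hamming s s')%:R - h%:R : R|]|%:R
    <= 2 * h.*2%:R * expR (- (eta ^+ 2 * h.*2%:R)) * #|slice (d:=h.*2) h|%:R.
Proof.
move=> h0 e0 e1.
have T1 := hamming_tail s' e0 e1; have T2 := hamming_tail (compl s') e0 e1.
set A := [pred s | _ & _].
set A1 := [pred s : bits h.*2 | _] in T1; set A2 := [pred s : bits h.*2 | _] in T2.
have cA : (#|A| <= #|A1| + #|A2|)%N.
  apply: (@leq_trans #|[predU A1 & A2]|).
    apply: subset_leq_card; apply/fintype.subsetP => s; rewrite !inE => /andP[_].
    have E : (hamming s s')%:R + (hamming s (compl s'))%:R = h%:R + h%:R :> R.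
      by rewrite -!natrD hammingC [hamming s _]hammingC hamming_compl addnn.
    have -> : (hamming s (compl s'))%:R - h%:R = - ((hamming s s')%:R - h%:R) :> R.
      lra.
    by rewrite ltr_normr.
  by rewrite -cardUI leq_addr.
have low : 4 ^+ h <= h.*2%:R * #|slice (d:=h.*2) h|%:R :> R.
  by rewrite -natrX -natrM ler_nat card_slice_lower.
apply: (@le_trans _ _ (#|A1|%:R + #|A2|%:R)); first by rewrite -natrD ler_nat.
apply: (le_trans (lerD T1 T2)).
have := ler_wpM2r (expR_ge0 (- (eta ^+ 2 * h.*2%:R))) low; lra.
Qed.

Lemma corr_norm_le1 (R : realType) (h : nat) (Gam : R) (s s' : bits h.*2) :
  `|corr (slice h) (gapk h Gam) s s'| <= 1.
Proof.
have N0 : 0 < #|slice (d:=h.*2) h|%:R :> R by rewrite ltr0n card_slice_gt0.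
rewrite /corr normrM normfV (ger0_norm (ler0n _ _)) ler_pdivrMl // mulr1.
apply: (le_trans (ler_norm_sum _ _ _)); rewrite -sum1_card natr_sum.
by apply: ler_sum => t _; rewrite normrM mulr_ile1 ?gapk_norm_le1.
Qed.

Lemma sum_corr_gapk (R : realType) (h : nat) (Gam : R) (s' : bits h.*2) :
  \sum_(s | slice h s) corr (slice h) (gapk h Gam) s s' = 0.
Proof.
set S := \sum_(s | _) _.
have : S = - S.
  rewrite {1}/S sum_slice_compl -sumrN; apply: eq_bigr => s _.
  exact: corr_compl.
lra.
Qed.

(** In the second-order expansion the linear term sums to zero, and lam^2 is at most lam / 1000. *)
Lemma corr_mgf_small (R : realType) (h : nat) (Gam lam : R) (s' : bits h.*2) :
  0 <= lam -> 1000 * lam <= 1 ->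
  \sum_(s | slice h s) expR (lam * corr (slice h) (gapk h Gam) s s')
    <= #|slice (d:=h.*2) h|%:R * expR (lam / 200).
Proof.
move=> lam0 lam1; set K := corr _ _.
have Kle s : expR (lam * K s s') <= 1 + lam * K s s' + lam ^+ 2.
  have K1 : `|K s s'| <= 1 by exact: corr_norm_le1.
  have lK : `|lam * K s s'| <= 3^-1.
    by rewrite normrM ger0_norm //; have := ler_wpM2l lam0 K1; lra.
  apply: (le_trans (expR_le_quadratic lK)); rewrite lerD2l exprMn ler_piMr ?sqr_ge0 //.
  by rewrite -real_normK ?num_real // exprn_ile1.
apply: (@le_trans _ _ (\sum_(s | slice h s) (1 + lam * K s s' + lam ^+ 2))).
  exact: ler_sum.
rewrite !big_split /= -mulr_sumr sum_corr_gapk mulr0 addr0 -big_split /=.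
rewrite sumr_const -[leLHS]mulr_natl; apply: ler_wpM2l; first exact: ler0n.
apply: le_trans (expR_ge1Dx _); rewrite lerD2l.
have := ler_wpM2l lam0 lam1; lra.
Qed.

(** Typical s contribute exp (lam / 500). Atypical s contribute at most exp lam each, but are so
    rare that their total share is at most 3 lam / 1000; the two exponents add up to lam / 200. *)
Lemma corr_mgf_large (R : realType) (h : nat) (Gam r lam eta : R) (s' : bits h.*2) :
  10 ^+ 4 <= r -> r ^+ 2 = h.*2%:R -> weight s' = h ->
  0 <= eta -> eta <= 3^-1 -> 10 ^+ 5 * eta <= (10 ^- 5) ^+ 2 -> 0 <= lam ->
  2 * h.*2%:R * expR (lam - eta ^+ 2 * h.*2%:R) <= 3 * lam / 1000 ->
  \sum_(s | slice h s) expR (lam * corr (slice h) (gapk h Gam) s s')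
    <= #|slice (d:=h.*2) h|%:R * expR (lam / 200).
Proof.
move=> r4 r2 s'h e0 e1 e2 lam0 Hlam; set K := corr _ _.
have r0 : 0 < r by apply: lt_le_trans r4.
have h0 : (0 < h)%N by case: (h) r2 => // /eqP; rewrite expf_eq0 /= gt_eqF.
set N : R := #|slice _|%:R.
pose bad := [pred s | slice h s & eta * h.*2%:R < `|(hamming s s')%:R - h%:R : R|].
have tail := slice_hamming_tail s' h0 e0 e1; rewrite -/N -/bad in tail.
have Kle s : slice h s ->
    expR (lam * K s s') <= expR (lam / 500) + (bad s)%:R * expR lam.
  move=> sh; rewrite /bad /= sh /=.
  case: ltP => H /=.
    rewrite mul1r; apply: ler_wpDl; first exact: expR_ge0.
    rewrite ler_expR ler_piMr //; apply: le_trans (corr_norm_le1 Gam s s').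
    exact: ler_norm.
  rewrite mul0r addr0 ler_expR ler_wpM2l //; apply: (le_trans (ler_norm _)).
  apply: (corr_gapk_upper _ r4 r2 (eqP sh) s'h _ _ e2 H); last by rewrite mulfV.
  by rewrite invr_gt0.
apply: (@le_trans _ _ (\sum_(s | slice h s)
    (expR (lam / 500) + (bad s)%:R * expR lam))); first exact: ler_sum.
rewrite big_split /= sumr_const -mulr_suml.
rewrite -natr_sum -big_mkcondr /=.
rewrite (_ : (\sum_(s | _) 1)%N = #|bad|); last first.
  by rewrite -sum1_card; apply: eq_bigl => s; rewrite inE /= andbA andbb.
rewrite -[X in X + _]mulr_natl.
have N0 : 0 <= N by exact: ler0n.
have X : #|bad|%:R * expR lam <= N * (3 * lam / 1000).
  apply: (le_trans (ler_wpM2r (expR_ge0 lam) tail)).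
  rewrite [leLHS]mulrAC [leLHS]mulrC ler_wpM2l //.
  by apply: le_trans Hlam; rewrite -[leLHS]mulrA -expRD addrC.
apply: (le_trans (lerD (lexx _) X)); rewrite -mulrDr ler_wpM2l //.
have -> : lam / 200 = lam / 500 + 3 * lam / 1000 by lra.
have a1 : 1 <= expR (lam / 500) by apply: le_trans (expR_ge1Dx _); lra.
have a2 := expR_ge1Dx (3 * lam / 1000).
rewrite expRD; nra.
Qed.

Lemma corr_mgf (R : realType) :
  exists2 c : R, 0 < c & forall (h : nat) (Gam r : R) (s' : bits h.*2),
  10 ^+ 4 <= r -> r ^+ 2 = h.*2%:R -> weight s' = h ->
  \sum_(s | slice h s) expR (c * h.*2%:R * corr (slice h) (gapk h Gam) s s')
    <= #|slice (d:=h.*2) h|%:R * expR (c * h.*2%:R / 200).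
Proof.
have [eta [eta0 eta1 eta2]] : exists eta : R,
    [/\ 0 < eta, eta <= 3^-1 & 10 ^+ 5 * eta <= (10 ^- 5) ^+ 2].
  pose x : R := 10 ^- 5.
  have x0 : 0 < x by rewrite invr_gt0.
  have x1 : x <= 1 by rewrite invf_le1 // exprn_ege1 // ler1n.
  (* The third power makes 10^5 eta equal to x^2 / 3. *)
  exists (x ^+ 3 / 3); split.
  - by rewrite divr_gt0 // exprn_gt0.
  - by rewrite -[leRHS]mul1r ler_pM2r // exprn_ile1 // ltW.
  - rewrite -[10 ^+ 5]invrK -/x.
    have -> : x^-1 * (x ^+ 3 / 3) = x ^+ 2 / 3 by field; rewrite gt_eqF.
    by have := sqr_ge0 x; lra.
(* Dimensions up to [M ^+ 3 / eta ^+ 4] count as small. *)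
have [M M1000] : exists M : R, 1000 <= M by exists 1000.
have M0 : 0 < M by lra.
have p0 : 0 <= 1000 :> R by exact: ler0n.
(* In small dimensions c d is then at most 1 / M, hence at most 1/1000. *)
pose c := eta ^+ 4 / M ^+ 4.
have c0 : 0 < c by rewrite divr_gt0 // exprn_gt0.
exists c => // h Gam r s' r4 r2 s'h.
set d : R := h.*2%:R in r2 *; have d0 : 0 <= d by exact: ler0n.
have eta4 : 0 < eta ^+ 4 by rewrite exprn_gt0.
have [small|large] := leP (eta ^+ 4 * d) (M ^+ 3).
  apply: corr_mgf_small; first by rewrite mulr_ge0 // ltW.
  have -> : c * d = eta ^+ 4 * d / M ^+ 4 by rewrite /c; ring.
  rewrite mulrA ler_pdivrMr ?exprn_gt0 // mul1r (exprS M 3).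
  by apply: (ler_pM p0 _ M1000 small); rewrite mulr_ge0 // ltW.
have z0 : 0 < eta ^+ 4 * d by apply: lt_trans large; rewrite exprn_gt0.
apply: (corr_mgf_large Gam r4 r2 s'h (ltW eta0) eta1 eta2).
  by rewrite mulr_ge0 // ltW.
(* Half of the tail exponent absorbs c d; the other half, exp (- y), must beat the constant c. *)
pose y := eta ^+ 2 * d / 2.
have y0 : 0 <= y by rewrite divr_ge0 // mulr_ge0 ?sqr_ge0.
have cle : c <= eta ^+ 2 / 2.
  rewrite ler_pdivrMr ?exprn_gt0 //.
  have -> : eta ^+ 4 = eta ^+ 2 * eta ^+ 2 by ring.
  rewrite -[leRHS]mulrA ler_wpM2l ?sqr_ge0 //.
  have e21 : eta ^+ 2 <= 2^-1 by nra.
  have M4 : 1 <= M ^+ 4 by rewrite exprn_ege1 //; lra.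
  lra.
have expy : y ^+ 2 / 4 <= expR y.
  have -> : y = y / 2 + y / 2 by lra.
  rewrite expRD -expr2; have := expR_ge1Dx (y / 2).
  have := expR_ge0 (y / 2); nra.
(* Since eta^4 d exceeds M^3, c y^2 / 4 exceeds M^6 / (16 M^4), far above the required 2000/3. *)
have cy : M ^+ 2 / 16 <= c * expR y.
  apply: (@le_trans _ _ (c * (y ^+ 2 / 4))); last by rewrite ler_wpM2l // ltW.
  have -> : c * (y ^+ 2 / 4) = (eta ^+ 4 * d) ^+ 2 / M ^+ 4 / 16.
    by rewrite /c /y; field; rewrite gt_eqF.
  rewrite ler_pM2r ?invr_gt0 // ler_pdivlMr ?exprn_gt0 // -exprD.
  by rewrite -[(2 + 4)%N]/(3 * 2)%N exprM lerXn2r ?nnegrE ?exprn_ge0 // ltW.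
have M2 : 1000 * 1000 <= M ^+ 2 by rewrite expr2; exact: (ler_pM p0 p0 M1000 M1000).
have H1 : expR (c * d - eta ^+ 2 * d) <= expR (- y).
  by rewrite ler_expR /y; have := ler_wpM2r d0 cle; lra.
have H2 : 2 * expR (- y) <= 3 / 1000 * c.
  by rewrite expRN ler_pdivrMr ?expR_gt0 // -mulrA; lra.
have := ler_wpM2l d0 H2; have := ler_wpM2l d0 H1; lra.
Qed.

(** * The input distribution, the success probability and averaging over coins *)

(** Far and close exclude each other, so the indicator of a correct answer is half that of a valid
    pair plus half the signed kernel: success is 1/2 plus a bias. *)
Lemma gapk_split (R : realType) (h d : nat) (Gam : R) (u v : bits d) (b : bool) :
  0 < Gam ->
  let f := (h%:R + Gam <= (hamming u v)%:R)%R in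
  let c := ((hamming u v)%:R <= h%:R - Gam)%R in
  (f%:R + c%:R) * (if b then f else c)%:R
  = 2^-1 * (f%:R + c%:R) + 2^-1 * ((-1) ^+ (~~ b) * gapk h Gam u v) :> R.
Proof.
move=> G0 f c; rewrite /gapk /gapf -/f -/c.
have : ~~ (f && c) by apply/negP => /andP[]; rewrite /f /c; lra.
by case: f; case: c => // _; case: b => /=; rewrite ?expr0 ?expr1; field.
Qed.

(** The slab between the thresholds has length 2 Gam = r / 500 and holds at most a quarter of the
    slice; complementing t splits the rest equally between far and close. *)
Lemma slice_far_half (R : realType) (h : nat) (Gam r : R) (u : bits h.*2) :
  10 ^+ 4 <= r -> r ^+ 2 = h.*2%:R -> 10 ^+ 3 * Gam = r -> weight u = h ->
  #|slice (d:=h.*2) h|%:R <=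
    4 * \sum_(t | slice h t) (h%:R + Gam <= (hamming u t)%:R)%R%:R :> R.
Proof.
move=> r4 r2 Gr uh; have r0 : 0 < r by apply: lt_le_trans r4.
have h0 : (0 < h)%N by case: (h) r2 => // /eqP; rewrite expf_eq0 /= gt_eqF.
have G0 : 0 <= 2 * Gam by lra.
have slab := slice_slab_upper (h%:R - Gam) h0 (ltW r0) r2 G0 uh.
set N : R := #|slice _|%:R in slab *; set B := #|_| in slab.
have N0 : 0 <= N by exact: ler0n.
have B4 : 4 * B%:R <= N.
  rewrite -(ler_pM2r r0).
  have : 3 * (2 * Gam + 1) * N <= r / 4 * N by rewrite ler_wpM2r //; lra.
  by move: slab; lra.
set far := \sum_(t | _) _.
have close : \sum_(t | slice h t) ((hamming u t)%:R <= h%:R - Gam)%R%:R = far.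
  rewrite /far sum_slice_compl; apply: eq_bigr => t _.
  have E : (hamming u t)%:R + (hamming u (compl t))%:R = h%:R + h%:R :> R.
    by rewrite -!natrD hammingC [hamming u (compl t)]hammingC hamming_compl addnn.
  by congr (nat_of_bool _)%:R; apply/idP/idP; lra.
have : N <= far + far + B%:R.
  rewrite -{2}close /N /B -!sum1_card !natr_sum big_mkcondr -!big_split /=.
  apply: ler_sum => t _; set x : R := (hamming u t)%:R.
  have [H1|H1] := leP (h%:R + Gam) x.
    by rewrite -addrA lerDl addr_ge0 //; case: ifP.
  have [H2|H2] := leP x (h%:R - Gam).
    by rewrite add0r lerDl; case: ifP.
  by rewrite !add0r ifT //; apply/andP; split; lra.
lra.
Qed.

Lemma sum_ffun_coord (R : realType) (T : finType) (W : pred T) (k : nat)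
    (i : 'I_k) (F : T -> R) :
  #|W|%:R * \sum_(s : {ffun 'I_k -> T} | s \in ffun_on W) F (s i) =
  #|W|%:R ^+ k * \sum_(u | W u) F u.
Proof.
have E (s : {ffun 'I_k -> T}) :
    F (s i) = \prod_j (if j == i then F (s j) else 1).
  by rewrite (bigD1 i) //= eqxx big1 ?mulr1 // => j /negbTE ->.
under eq_bigr do rewrite E.
rewrite -(bigA_distr_big _ (fun j u => if j == i then F u else 1)).
have -> : #|W|%:R ^+ k = \prod_(j < k) #|W|%:R :> R.
  by rewrite prodr_const card_ord.
rewrite [in LHS](bigD1 i) //= [in RHS](bigD1 i) //= eqxx -mulrA; congr (_ * _).
rewrite mulrC; congr (_ * _); apply: eq_bigr => j /negbTE ->.
by rewrite sumr_const.
Qed.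

Lemma prod_bool (R : realType) (I : finType) (b : I -> bool) :
  \prod_i (b i)%:R = [forall i, b i]%:R :> R.
Proof.
case: forallP => [H|H]; first by rewrite big1 // => i _; rewrite H.
have [i bi] : exists i, ~~ b i.
  by apply/existsP; rewrite -negb_forall; apply/forallP.
by rewrite (bigD1 i) //= (negbTE bi) mul0r.
Qed.

(** Fixing the coins: sum and integral are exchanged, so a bound valid for every outcome of the
    coins bounds the average. *)
Lemma prob_avg_le (R : realType) (disp : measure_display)
    (Om : measurableType disp) (P : probability Om R) (X : finType)
    (w : X -> R) (E : X -> Om -> bool) (B : R) :
  (forall x, 0 <= w x) ->
  (forall x, measurable [set o | E x o]%classic) ->
  (forall o, \sum_x w x * (E x o)%:R <= B) ->
  (\sum_x (w x)%:E * P [set o | E x o]%classic <= B%:E)%E.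
Proof.
move=> w0 mE HB.
have mi x : measurable_fun [set: Om]%classic
    (fun o => (\1_[set o | E x o]%classic o : R)%:E).
  by apply/measurable_EFinP; exact: measurable_indic.
have -> : (\sum_x (w x)%:E * P [set o | E x o]%classic =
    \int[P]_o \sum_x (w x)%:E * (\1_[set o | E x o]%classic o)%:E)%E.
  rewrite ge0_integral_sum //.
  - apply: eq_bigr => x _; rewrite ge0_integralZl_EFin //.
    by rewrite integral_indic // setIT.
  - by move=> x; exact: measurable_funeM.
  - by move=> x o _; rewrite -EFinM lee_fin mulr_ge0.
rewrite -[leRHS]mule1 -(probability_setT P) -integral_cst //.
apply: ge0_le_integral => //.
- by move=> o _; apply: sume_ge0 => x _; rewrite -EFinM lee_fin mulr_ge0.
- by apply: emeasurable_sum => x; exact: measurable_funeM.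
- move=> o _; under eq_bigr do rewrite -EFinM.
  rewrite sumEFin lee_fin; apply: le_trans (HB o).
  by apply: ler_sum => x _; rewrite indicE mem_setE.
Qed.

Lemma card_close_pairs (R : realType) (eps : R) (h : nat) :
  1 / (2 * eps ^+ 2) = h%:R ->
  #|close_pairs eps (d:=h.*2) h| = #|far_pairs eps (d:=h.*2) h|.
Proof.
move=> eh; pose f (p : bits h.*2 * bits h.*2) := (compl p.1, p.2).
have fK : involutive f by move=> [u v]; rewrite /f /= complK.
rewrite -!sum1_card [RHS](reindex_inj (inv_inj fK)); apply: eq_bigl => -[u v].
rewrite unfold_in [RHS]unfold_in /far_pairs /close_pairs /=.
congr [&& _, _ & _].
  by have := weight_compl u; lia.
have E : (hamming u v)%:R + (hamming (compl u) v)%:R = h%:R + h%:R :> R.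
  by rewrite -!natrD hamming_compl addnn.
by rewrite /is_close /is_far eh; apply/idP/idP; lra.
Qed.

(** Far and close pairs are equinumerous, so the fair mixture has the same density on both. The k -
    1 free strings give N^-(k-1), written N / N^k with N the size of the slice. *)
Lemma massE (R : realType) (eps : R) (k h : nat) (s : {ffun 'I_k -> bits h.*2})
    (i : 'I_k) (t : bits h.*2) :
  1 / (2 * eps ^+ 2) = h%:R ->
  mass eps h (s, i, t) =
    #|slice (d:=h.*2) h|%:R
    / (k%:R * (2 * #|far_pairs eps (d:=h.*2) h|%:R) * #|slice (d:=h.*2) h|%:R ^+ k)
    * ((s \in ffun_on (slice h)) && slice h t)%:R
    * ((is_far eps (s i) t)%:R + (is_close eps (s i) t)%:R).
Proof.
move=> eh; rewrite /mass /unif card_close_pairs //.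
set N : R := #|slice _|%:R; set Q : R := #|far_pairs _ _|%:R.
have N0 : N != 0 by rewrite pnatr_eq0 -lt0n card_slice_gt0.
have -> : #|(predT : pred 'I_k)| = k by rewrite -[RHS]card_ord; apply: eq_card.
have P : (slice h (s i))%:R * \prod_(j | j != i)
    ((weight (s j) == h)%:R / #|fun u : bits h.*2 => weight u == h|%:R) =
    N * (s \in ffun_on (slice h))%:R / N ^+ k.
  have -> : (s \in ffun_on (slice h)) = [forall j, slice h (s j)].
    by apply/ffun_onP/forallP.
  have : \prod_j ((slice h (s j))%:R / N) = [forall j, slice h (s j)]%:R / N ^+ k.
    by rewrite prodf_div prod_bool prodr_const card_ord.
  rewrite (bigD1 i) //= => H; rewrite -[RHS]mulrA -H.
  by rewrite mulrA mulrCA mulfV // mulr1.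
rewrite /far_pairs /close_pairs /= -/(slice h (s i)) -/(slice h t).
rewrite !andbA -!mulnb !natrM.
transitivity (k%:R^-1 * 2^-1 * Q^-1 * (slice h t)%:R *
   ((is_far eps (s i) t)%:R + (is_close eps (s i) t)%:R) *
   ((slice h (s i))%:R * \prod_(j | j != i)
    ((weight (s j) == h)%:R / #|fun u : bits h.*2 => weight u == h|%:R))).
  by rewrite mulr1n; ring.
rewrite P !invfM; ring.
Qed.

Lemma card_far_pairs_lower (R : realType) (eps : R) (h : nat) :
  0 < eps -> 1 / (2 * eps ^+ 2) = h%:R -> 10 ^+ 4 <= 1 / eps ->
  (1 / eps) ^+ 2 = h.*2%:R ->
  #|slice (d:=h.*2) h|%:R ^+ 2 <= 4 * #|far_pairs eps (d:=h.*2) h|%:R :> R.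
Proof.
move=> eps0 eh r4 r2.
have -> : #|far_pairs eps (d:=h.*2) h|%:R =
    \sum_(u : bits h.*2 | slice h u) \sum_(t | slice h t) (is_far eps u t)%:R :> R.
  rewrite pair_big /= -sum1_card natr_sum big_mkcond /= [RHS]big_mkcond /=.
  apply: eq_bigr => -[u t] _; rewrite unfold_in /far_pairs /= /slice.
  by case: (weight u == h); case: (weight t == h) => //=; case: (is_far eps u t).
rewrite mulr_sumr expr2 -{1}sum1_card natr_sum mulr_suml; apply: ler_sum => u /eqP uh.
rewrite mul1r /is_far eh; apply: (slice_far_half r4 r2 _ uh).
by rewrite /gapc; field; rewrite gt_eqF.
Qed.

(** The success probability is 1/2 + N S / (2 Z), where S is the signed sum and Z the normalisation.
    An excess of 1/10 gives N S >= Z / 5, and N^2 <= 4 Q, with Q the number of far pairs, turns this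
    into theta = 1/10. *)
Lemma success_advantage (R : realType) (eps : R) (k h : nat) (Msg : finType)
    (A : {ffun 'I_k -> bits h.*2} -> Msg) (B : Msg -> 'I_k -> bits h.*2 -> bool) :
  (0 < k)%N -> 0 < eps -> 1 / (2 * eps ^+ 2) = h%:R -> 10 ^+ 4 <= 1 / eps ->
  (1 / eps) ^+ 2 = h.*2%:R ->
  3 / 5 <= \sum_(x : input k h.*2) mass eps h x *
     (correct eps (B (A x.1.1) x.1.2 x.2) (x.1.1 x.1.2) x.2)%:R ->
  10^-1 * (#|slice (d:=h.*2) h|%:R ^+ k.+1 * k%:R) <=
    \sum_(s : {ffun 'I_k -> bits h.*2} | s \in ffun_on (slice h))
      \sum_i \sum_(t | slice h t)
        (-1) ^+ (~~ B (A s) i t) * gapk h (gapc R / eps) (s i) t.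
Proof.
move=> k0 eps0 eh r4 r2; set S := (X in _ -> _ <= X).
set N : R := #|slice _|%:R; set Q : R := #|far_pairs eps (d:=h.*2) h|%:R.
have N0 : 0 < N by rewrite ltr0n card_slice_gt0.
have QN : N ^+ 2 <= 4 * Q by exact: card_far_pairs_lower.
have Q0 : 0 < Q by have := exprn_gt0 2 N0; lra.
have kR : 0 < k%:R :> R by rewrite ltr0n.
have G0 : 0 < gapc R / eps by rewrite divr_gt0 // /gapc invr_gt0.
set Z := k%:R * (2 * Q) * N ^+ k.
have Z0 : 0 < Z by rewrite !mulr_gt0 // exprn_gt0.
pose fc (u t : bits h.*2) : R := (is_far eps u t)%:R + (is_close eps u t)%:R.
have tot : \sum_(u : bits h.*2 | slice h u) \sum_(t | slice h t) fc u t = 2 * Q.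
  transitivity (#|far_pairs eps (d:=h.*2) h|%:R + #|close_pairs eps (d:=h.*2) h|%:R : R).
    rewrite pair_big /= -!sum1_card !natr_sum !(big_mkcond (fun _ => _ \in _)) /=.
    rewrite big_mkcond -big_split /=; apply: eq_bigr => -[u t] _.
    rewrite !unfold_in /far_pairs /close_pairs /= /slice /fc.
    by case: (weight u == h); case: (weight t == h) => /=; rewrite ?addr0 //;
      case: (is_far eps u t); case: (is_close eps u t).
  by rewrite card_close_pairs // -/Q; ring.
have avg : N * \sum_(s : {ffun 'I_k -> bits h.*2} | s \in ffun_on (slice h))
    \sum_i \sum_(t | slice h t) fc (s i) t = Z.
  rewrite exchange_big /= mulr_sumr; transitivity (\sum_(i < k) N ^+ k * (2 * Q)).
    apply: eq_bigr => i _.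
    by rewrite (sum_ffun_coord _ i (fun u => \sum_(t | slice h t) fc u t)) tot.
  by rewrite sumr_const card_ord -[LHS]mulr_natl /Z; ring.
have -> : \sum_(x : input k h.*2) mass eps h x *
     (correct eps (B (A x.1.1) x.1.2 x.2) (x.1.1 x.1.2) x.2)%:R =
    2^-1 + N / Z * (2^-1 * S).
  transitivity (\sum_(s : {ffun 'I_k -> bits h.*2} | s \in ffun_on (slice h))
      \sum_i \sum_(t | slice h t) (2^-1 / Z * (N * fc (s i) t) + N / Z * (2^-1 *
        ((-1) ^+ (~~ B (A s) i t) * gapk h (gapc R / eps) (s i) t)))).
    pose w s i t := mass eps h ((s, i, t) : input k h.*2).
    transitivity (\sum_s \sum_i \sum_t w s i t *
       (correct eps (B (A s) i t) (s i) t)%:R).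
      rewrite pair_bigA pair_bigA /=.
      by apply: eq_bigr => -[[s i] t] _.
    rewrite [RHS]big_mkcond /=; apply: eq_bigr => s _.
    case: ifP => sW; last first.
      rewrite big1 // => i _; rewrite big1 // => t _.
      by rewrite /w massE // sW mulr0 !mul0r.
    apply: eq_bigr => i _; rewrite [RHS]big_mkcond /=; apply: eq_bigr => t _.
    rewrite /w massE // sW -/N -/Q -/Z; case: (slice h t); last by rewrite mulr0 !mul0r.
    rewrite mulr1 -[LHS]mulrA /fc /is_far /is_close eh.
    have := gapk_split h (s i) t (B (A s) i t) G0.
    rewrite /correct /is_far /is_close eh => ->; ring.
  under eq_bigr do under eq_bigr do rewrite big_split -!mulr_sumr /=.
  under eq_bigr do rewrite big_split -!mulr_sumr /=.
  rewrite big_split -!mulr_sumr /= -/S; congr (_ + _).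
  by rewrite avg mulfVK // gt_eqF.
move=> H; have {}H : 5^-1 * Z <= N * S.
  have : 5^-1 <= N / Z * S by lra.
  by rewrite mulrAC ler_pdivlMr.
rewrite -(ler_pM2l N0); apply: le_trans H.
have := ler_wpM2r (ltW (mulr_gt0 kR (exprn_gt0 k N0))) QN.
rewrite /Z (exprS N k); lra.
Qed.

(** A protocol provides measurability for each fixed message only, so the event is split into
    finitely many pieces by the message sent. *)
Lemma measurable_correct (R : realType) (eps : R) (k d m : nat)
    (disp : measure_display) (Om : measurableType disp)
    (prot : protocol Om k d m) (s : {ffun 'I_k -> bits d}) (i : 'I_k) (t : bits d) :
  measurable [set w | correct eps (bob prot w (alice prot w s) i t) (s i) t]%classic.
Proof.
have -> : [set w | correct eps (bob prot w (alice prot w s) i t) (s i) t]%classic =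
    (\bigcup_(M in [set: bits m])
      ([set w | alice prot w s = M] `&`
       (if is_far eps (s i) t then [set w | bob prot w M i t] else set0) `|`
       [set w | alice prot w s = M] `&`
       (if is_close eps (s i) t then ~` [set w | bob prot w M i t] else set0)))%classic.
  apply/seteqP; split => w /=.
    rewrite /correct; case E: (bob _ _ _ _ _) => H; exists (alice prot w s) => //.
      by left; rewrite H.
    by right; rewrite H; split => //=; rewrite E.
  move=> [M _ [[<-]|[<-]]]; rewrite /correct.
    by case: (is_far eps (s i) t) => //= ->.
  by case: (is_close eps (s i) t) => //= /negP/negbTE ->.
apply: fin_bigcup_measurable => // M _.
apply: measurableU; apply: measurableI; do ?exact: measurable_alice.
  by case: ifP => // _; exact: measurable_bob.
by case: ifP => // _; exact/measurableC/measurable_bob.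
Qed.

Lemma mass_ge0 (R : realType) (eps : R) (k d h : nat) (x : input k d) :
  0 <= mass eps h x.
Proof.
case: x => [[s i] t]; rewrite /mass /unif.
by rewrite !mulr_ge0 ?prodr_ge0 ?addr_ge0 // => *; rewrite ?mulr_ge0 ?invr_ge0.
Qed.

(** * The communication lower bound *)

Theorem theorem2p3 (R : realType) :
  exists2 C : R, 0 < C &
  forall (n : nat) (eps : R) (d h m : nat)
    (disp : measure_display) (Om : measurableType disp)
    (P : probability Om R) (prot : protocol Om n./2 d m),
    ~~ odd n ->
    0 < eps -> eps <= gapc R / 10 ->
    1 / eps ^+ 2 = d%:R -> 1 / (2 * eps ^+ 2) = h%:R ->
    ((2 / 3)%:E <= success eps h P prot)%E ->
    C * (n%:R / eps ^+ 2) <= m%:R.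
Proof.
have [c c0 mgf] := corr_mgf R.
(* With theta = 1/10, lam = c d and phi = c d / 200, the message bound leaves c d k / 200 <= m ln 2,
   and n / eps^2 is 2 k d. *)
exists (c / 400); first by rewrite divr_gt0.
move=> n eps d h m disp Om P prot nodd eps0 eps1 ed eh succ.
have dh : d = h.*2.
  apply/eqP; rewrite -(eqr_nat R) -muln2 natrM -eh -ed; apply/eqP; field.
  by rewrite gt_eqF.
subst d.
have nk : n%:R = 2 * n./2%:R :> R.
  by rewrite -{1}(odd_double_half n) (negbTE nodd) add0n -muln2 natrM mulrC.
move: n./2 nk prot succ => k nk prot succ {nodd}.
have r2 : (1 / eps) ^+ 2 = h.*2%:R by rewrite -ed expr_div_n expr1n.
have r4 : 10 ^+ 4 <= 1 / eps.
  rewrite ler_pdivlMr //; move: eps1; rewrite /gapc; lra.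
have -> : n%:R / eps ^+ 2 = 2 * k%:R * h.*2%:R by rewrite nk -ed mul1r.
have [->|k0] := posnP k; first by rewrite mulr0 mul0r mulr0.
rewrite leNgt; apply/negP => mlt.
(* If the message is too short, every deterministic protocol obtained by fixing the coins succeeds
   with probability at most 3/5, strictly below 2/3. *)
have det w : \sum_(x : input k h.*2) mass eps h x *
    (correct eps (bob prot w (alice prot w x.1.1) x.1.2 x.2) (x.1.1 x.1.2) x.2)%:R
    <= 3 / 5.
  rewrite leNgt; apply/negP => /ltW.
  move=> /(success_advantage k0 eps0 eh r4 r2) adv.
  have N0 := card_slice_gt0 h.
  have lam0 : 0 <= c * h.*2%:R by rewrite mulr_ge0 // ltW.
  have t0 : 0 <= 10^-1 :> R by [].
  have sgn (M : bits m) (i : 'I_k) (t : bits h.*2) :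
      ((-1) ^+ (~~ bob prot w M i t)) ^+ 2 <= 1 :> R by rewrite sqrr_sign.
  have mgf' (s' : bits h.*2) : slice h s' -> \sum_(s | slice h s)
      expR (c * h.*2%:R * corr (slice h) (gapk h (gapc R / eps)) s s')
      <= #|slice (d:=h.*2) h|%:R * expR (c * h.*2%:R / 200).
    by move=> /eqP s'h; exact: (mgf _ _ (1 / eps)).
  have := advantage_le_message_size N0 lam0 t0 sgn mgf' adv.
  rewrite card_tuple card_bool natrX lnXn // -mulr_natr => H.
  have ln2 : ln 2 <= 1 :> R.
    by have := @le_ln1Dx R 1; rewrite -[1 + 1]/(2 : R); apply; lra.
  have := ler_wpM2r (ler0n R m) ln2.
  move: H mlt; lra.
have /(le_trans succ) := prob_avg_le P (@mass_ge0 _ eps _ _ h)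
  (fun x => measurable_correct eps prot x.1.1 x.1.2 x.2) det.
rewrite lee_fin; lra.
Qed.
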